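(* Let $p\ge2$ be an integer, $r\in\{0,\dots,p-1\}$, and let $f:\mathbb{Z}_p\to\mathbb{Z}_p$ be a function such that $f(r+p\mathbb{Z}_p)\subseteq p\mathbb{Z}_p$ and $f$ is $(p,r)$-suitable. Then $f$ has a unique root in $r+p\mathbb{Z}_p$.
   Context: $p\ge2$ is an integer, not necessarily prime. $\mathbb{Z}_p=\varprojlim \mathbb{Z}/p^k\mathbb{Z}$; every $a\in\mathbb{Z}_p$ is uniquely $a=\sum_{i\ge0}a_ip^i$ with $a_i\in\{0,\dots,p-1\}$, and $a\,\%\,p:=a_0$. A function $f:\mathbb{Z}_p\to\mathbb{Z}_p$ is $(p,r)$-suitable if for all integers $k\ge0$ and all $m,n\in r+p\mathbb{Z}_p$: $m\equiv n\pmod{p^k}$ if and only if $f(m)-(f(m)\%p)\equiv f(n)-(f(n)\%p)\pmod{p^k}$. *)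

(* Defs.v *)
From HB Require Import structures.
From mathcomp Require Import all_boot all_order all_algebra.
From mathcomp Require Import boolp classical_sets.
Set Implicit Arguments.
Unset Strict Implicit.
Unset Printing Implicit Defensive.
Import Order.TTheory GRing.Theory Num.Theory.
Local Open Scope ring_scope.
Local Open Scope classical_set_scope.

(* The inverse limit of the rings Z/p^k, k >= 0. A class modulo p^k is encoded
   by its representative in [0, p^k[ : [res x k] is that of the k-th component
   of x. The single equation [res_coh] states both that representatives are
   reduced and that components are compatible with Z/p^(k+1) -> Z/p^k.
   ('Z_(p ^ k) is not usable here, since 'Z_1 is not the zero ring.) *)
Record padic (p : nat) := Padic {
  res : nat -> int;
  res_coh : forall k, (res k.+1 %% p%:Z ^+ k)%Z = res k
}.

HB.instance Definition _ p := gen_eqMixin (padic p).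
HB.instance Definition _ p := gen_choiceMixin (padic p).

Section PadicRing.
Variable p : nat.
Implicit Types (x y z : padic p) (u v : nat -> int) (m : int).

Lemma padicP x y : (forall k, res x k = res y k) -> x = y.
Proof.
case: x y => [u hu] [v hv] /= e; have {e}e : u = v by apply: funext.
by subst v; congr Padic; exact: Prop_irrelevance.
Qed.

Lemma modz_mod_exp m k : ((m %% p%:Z ^+ k.+1)%Z %% p%:Z ^+ k)%Z = (m %% p%:Z ^+ k)%Z.
Proof. by rewrite {2}(divz_eq m (p%:Z ^+ k.+1)) exprS mulrA modzMDl. Qed.

Lemma res_mod x k : (res x k %% p%:Z ^+ k)%Z = res x k.
Proof. by rewrite -{1}res_coh modz_mod res_coh. Qed.

Fact reduce_coh u :
    (forall k, (u k.+1 = u k %[mod p%:Z ^+ k])%Z) ->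
  forall k, ((u k.+1 %% p%:Z ^+ k.+1)%Z %% p%:Z ^+ k)%Z = (u k %% p%:Z ^+ k)%Z.
Proof. by move=> h k; rewrite modz_mod_exp. Qed.

Definition padic_reduce u (h : forall k, (u k.+1 = u k %[mod p%:Z ^+ k])%Z) :=
  Padic (reduce_coh h).

Definition padic_const m : padic p :=
  @padic_reduce (fun=> m) (fun k => erefl).

Fact add_coh x y k :
  (res x k.+1 + res y k.+1 = res x k + res y k %[mod p%:Z ^+ k])%Z.
Proof. by rewrite -modzDm !res_coh. Qed.
Definition padic_add x y := padic_reduce (add_coh x y).

Fact opp_coh x k : (- res x k.+1 = - res x k %[mod p%:Z ^+ k])%Z.
Proof. by rewrite -modzNm res_coh. Qed.
Definition padic_opp x := padic_reduce (opp_coh x).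

Fact mul_coh x y k :
  (res x k.+1 * res y k.+1 = res x k * res y k %[mod p%:Z ^+ k])%Z.
Proof. by rewrite -modzMm !res_coh. Qed.
Definition padic_mul x y := padic_reduce (mul_coh x y).

Fact padic_addA : associative padic_add.
Proof. by move=> x y z; apply: padicP => k /=; rewrite modzDml modzDmr addrA. Qed.
Fact padic_addC : commutative padic_add.
Proof. by move=> x y; apply: padicP => k /=; rewrite addrC. Qed.
Fact padic_add0 : left_id (padic_const 0) padic_add.
Proof. by move=> x; apply: padicP => k /=; rewrite modzDml add0r res_mod. Qed.
Fact padic_addN : left_inverse (padic_const 0) padic_opp padic_add.
Proof. by move=> x; apply: padicP => k /=; rewrite modzDml addNr. Qed.
Fact padic_mulA : associative padic_mul.
Proof. by move=> x y z; apply: padicP => k /=; rewrite modzMml modzMmr mulrA. Qed.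
Fact padic_mulC : commutative padic_mul.
Proof. by move=> x y; apply: padicP => k /=; rewrite mulrC. Qed.
Fact padic_mul1 : left_id (padic_const 1) padic_mul.
Proof. by move=> x; apply: padicP => k /=; rewrite modzMml mul1r res_mod. Qed.
Fact padic_mulD : left_distributive padic_mul padic_add.
Proof.
by move=> x y z; apply: padicP => k /=; rewrite modzMml modzDm mulrDl.
Qed.

HB.instance Definition _ := GRing.isZmodule.Build (padic p)
  padic_addA padic_addC padic_add0 padic_addN.
HB.instance Definition _ := GRing.Zmodule_isComPzRing.Build (padic p)
  padic_mulA padic_mulC padic_mul1 padic_mulD.

End PadicRing.

Section Digits.
Variable p : nat.
Implicit Types (a : padic p) (d : nat -> int).

Definition digit a i : int := (res a i.+1 %/ p%:Z ^+ i)%Z.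

Lemma digit_bound a i : (0 < p)%N -> 0 <= digit a i < p%:Z.
Proof.
move=> p0; have pi0 : 0 < p%:Z ^+ i by rewrite exprn_gt0.
have pS0 : 0 < p%:Z ^+ i.+1 by rewrite exprn_gt0.
rewrite /digit -(res_mod a i.+1) divz_ge0 // modz_ge0 ?gt_eqF //=.
by rewrite ltz_divLR // -exprS ltz_pmod.
Qed.

Lemma digit_expansion a k :
  res a k = \sum_(i < k) digit a i * p%:Z ^+ i.
Proof.
elim: k => [|k IH]; first by rewrite big_ord0 -res_mod expr0 modz1.
by rewrite big_ord_recr /= -IH addrC -(res_coh a k) -divz_eq.
Qed.

Lemma digit_uniq a d :
    (forall i, 0 <= d i < p%:Z) ->
    (forall k, (res a k = \sum_(i < k) d i * p%:Z ^+ i %[mod p%:Z ^+ k])%Z) ->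
  d = digit a.
Proof.
move=> hd ha; have p0 : (0 < p)%N.
  by case/andP: (hd 0%N) => h1 h2; have := le_lt_trans h1 h2.
have hs k : 0 <= \sum_(i < k) d i * p%:Z ^+ i < p%:Z ^+ k.
  elim: k => [|k /andP[h1 h2]]; first by rewrite big_ord0.
  rewrite big_ord_recr /=; case/andP: (hd k) => d0 dp; apply/andP; split.
    by rewrite addr_ge0 // mulr_ge0 // exprn_ge0.
  apply: (@lt_le_trans _ _ ((d k + 1) * p%:Z ^+ k)).
    by rewrite mulrDl mul1r addrC ltrD2l.
  by rewrite exprS ler_wpM2r ?exprn_ge0 // lezD1.
have e k : res a k = \sum_(i < k) d i * p%:Z ^+ i.
  by rewrite -res_mod ha modz_small.
apply: funext => i; have pi0 : p%:Z ^+ i != 0 by rewrite expf_neq0 // gt_eqF.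
apply: (mulIf pi0); apply: (addrI (res a i)).
have := digit_expansion a i.+1; rewrite e !big_ord_recr /= -e => ->.
by rewrite -digit_expansion.
Qed.

End Digits.

(* a % p, the digit a_0 seen in Z_p *)
Definition padic_rem p (a : padic p) : padic p := (digit a 0)%:~R.

(* r + p Z_p *)
Definition residue_class (p r : nat) : set (padic p) :=
  [set r%:R + p%:R * z | z in setT].
Arguments residue_class : clear implicits.

(* p^k Z_p *)
Definition pow_ideal (p k : nat) : set (padic p) :=
  [set p%:R ^+ k * z | z in setT].
Arguments pow_ideal : clear implicits.

Definition padic_cong p (k : nat) (x y : padic p) : Prop := pow_ideal p k (x - y).

Definition suitable (p r : nat) (f : padic p -> padic p) : Prop :=
  forall (k : nat) (m n : padic p),
    residue_class p r m -> residue_class p r n ->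
    (padic_cong k m n <->
     padic_cong k (f m - padic_rem (f m)) (f n - padic_rem (f n))).

(* Main.v *)
Require Import Defs.
From mathcomp Require Import all_boot all_order all_algebra.
From mathcomp Require Import boolp classical_sets.
Import GRing.Theory.
Local Open Scope ring_scope.
Local Open Scope classical_set_scope.

(** Writing [f (r + p w) = p (h w)], suitability says that [h] is an isometry of
    Z_p: it preserves and reflects congruence modulo every [p ^ k]. Hence it
    induces an injection, so a bijection, of each finite ring Z/p^k; preimages
    of [0] modulo [p ^ k] exist for every [k], are unique modulo [p ^ k], and
    therefore form a coherent sequence, whose limit is the only zero of [h]. *)

Lemma PoszX (m k : nat) : (m ^ k)%N%:Z = m%:Z ^+ k.
Proof. by rewrite -natz natrX natz. Qed.

Lemma res_modX {p} (x : padic p) (j k : nat) :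
  (res x (j + k) %% p%:Z ^+ k)%Z = res x k.
Proof.
elim: j => [|j IH]; first by rewrite res_mod.
rewrite addSn -IH -(res_coh x (j + k)) exprD.
by rewrite {1}(divz_eq (res x (j + k).+1) (p%:Z ^+ j * p%:Z ^+ k)) mulrA modzMDl.
Qed.

Lemma resM {p} (x y : padic p) k :
  res (x * y) k = ((res x k * res y k) %% p%:Z ^+ k)%Z.
Proof. by []. Qed.

Lemma resB {p} (x y : padic p) k :
  res (x - y) k = ((res x k - res y k) %% p%:Z ^+ k)%Z.
Proof.
rewrite -[LHS]/((res x k + (- res y k %% p%:Z ^+ k)%Z) %% p%:Z ^+ k)%Z.
by rewrite modzDmr.
Qed.

Lemma res_nat {p} (n k : nat) : res (n%:R : padic p) k = (n%:Z %% p%:Z ^+ k)%Z.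
Proof.
elim: n => [//|n IH]; rewrite mulrS.
rewrite -[LHS]/(((1 %% p%:Z ^+ k)%Z + res (n%:R : padic p) k) %% p%:Z ^+ k)%Z.
by rewrite IH modzDm -intS.
Qed.

Lemma res_bound {p} (x : padic p) k : (0 < p)%N -> 0 <= res x k < p%:Z ^+ k.
Proof.
move=> p0; have pk0 : 0 < p%:Z ^+ k by rewrite Num.Theory.exprn_gt0.
by rewrite -res_mod modz_ge0 ?ltz_pmod // Order.POrderTheory.gt_eqF.
Qed.

(** Scaling a residue modulo [p ^ k] by [p] scales the modulus too, so no reduction is left and the
    level rises by one. This makes [p] cancellable by integer division. *)
Lemma res_pmul {p} (w : padic p) k : (0 < p)%N ->
  res (p%:R * w) k.+1 = p%:Z * res w k.
Proof.
move=> p0; rewrite resM res_nat modzMml exprS.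
by rewrite -mulz_modr ?res_coh.
Qed.

Lemma pow_idealP {p} k (x : padic p) : (0 < p)%N ->
  pow_ideal p k x <-> res x k = 0.
Proof.
move=> p0; have pk0 : p%:Z ^+ k != 0 by rewrite expf_neq0 // -lt0n.
split=> [[z _ <-]|x0].
  by rewrite resM -natrX res_nat PoszX modzz mul0r mod0z.
(* Dividing by [p ^ k] costs [k] levels of precision, so component [j] of the quotient is read off
   level [j + k]; the division is exact because [res x k = 0]. *)
have divE j : (res x (j + k) %/ p%:Z ^+ k)%Z * p%:Z ^+ k = res x (j + k).
  by rewrite [RHS](divz_eq _ (p%:Z ^+ k)) res_modX x0 addr0.
have coh j : ((res x (j.+1 + k) %/ p%:Z ^+ k)%Z = (res x (j + k) %/ p%:Z ^+ k)%Z
               %[mod p%:Z ^+ j])%Z.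
  rewrite addSn -[in RHS](res_coh x (j + k)) exprD.
  rewrite {1}(divz_eq (res x (j + k).+1) (p%:Z ^+ j * p%:Z ^+ k)).
  by rewrite mulrA divzMDl // modzMDl.
exists (padic_reduce coh) => //; apply: padicP => j.
rewrite resM -natrX res_nat /= modzMml modzMmr mulrC PoszX divE.
by rewrite addnC res_modX.
Qed.

Lemma padic_congP {p} k (x y : padic p) : (0 < p)%N ->
  padic_cong k x y <-> res x k = res y k.
Proof.
move=> p0; rewrite /padic_cong pow_idealP // resB.
split=> [/dvdz_mod0P|->]; last by rewrite subrr mod0z.
by rewrite -eqz_mod_dvd !res_mod => /eqP.
Qed.

Lemma padic_isometry_surj {p} (h : padic p -> padic p) : (0 < p)%N ->
    (forall k x y, res x k = res y k <-> res (h x) k = res (h y) k) ->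
  forall y, exists x, h x = y.
Proof.
move=> p0 hI y.
have approx k : exists x, res (h x) k = res y k.
  have lt_res (x : padic p) : (`|res x k| < p ^ k)%N.
    have /andP[x0 xk] := res_bound x k p0.
    by rewrite -ltz_nat gez0_abs // PoszX.
  have absK (x : padic p) : `|res x k|%N%:Z = res x k.
    by have /andP[x0 _] := res_bound x k p0; rewrite gez0_abs.
  (* The map induced by [h] on Z/p^k, computed on the representatives below [p ^ k]; it is injective
     since [h] reflects congruence. *)
  pose g (j : 'I_(p ^ k)) := Ordinal (lt_res (h (j : nat)%:R)).
  have g_inj : injective g.
    move=> i j /(congr1 val)/= /(congr1 Posz); rewrite !absK => /(proj2 (hI _ _ _)).
    rewrite !res_nat -PoszX !modz_nat => -[].
    by rewrite !modn_small // => /val_inj.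
  have [g' _ gK] := injF_bij g_inj.
  exists (g' (Ordinal (lt_res y)) : nat)%:R.
  by have /(congr1 val)/= /(congr1 Posz) := gK (Ordinal (lt_res y)); rewrite !absK.
have [x hx] := choice approx.
(* Both [h (x k.+1)] and [h (x k)] agree with [y] modulo [p ^ k], and [h] reflects this. *)
have coh k : (res (x k.+1) k.+1 = res (x k) k %[mod p%:Z ^+ k])%Z.
  rewrite res_coh res_mod; apply/hI.
  by rewrite hx -(res_coh (h _)) hx res_coh.
(* The limit agrees with [x k] modulo [p ^ k], and [h] preserves this. *)
exists (padic_reduce coh); apply: padicP => k.
by rewrite -(hx k); apply/(proj1 (hI _ _ _)); rewrite /= res_mod.
Qed.

Theorem theorem5p2 (p r : nat) (f : padic p -> padic p) :
  (2 <= p)%N -> (r < p)%N ->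
  f @` residue_class p r `<=` [set p%:R * z | z in setT] ->
  suitable r f ->
  exists! x : padic p, residue_class p r x /\ f x = 0.
Proof.
move=> p2 _ fp fs; have p0 : (0 < p)%N := ltnW p2.
have rc w : residue_class p r (r%:R + p%:R * w) by exists w.
have exh w : exists z, f (r%:R + p%:R * w) = p%:R * z.
  by have [|z _ <-] := fp (f (r%:R + p%:R * w)); [exists (r%:R + p%:R * w)|exists z].
have [h hE] := choice exh.
have rem0 z : padic_rem (p%:R * z : padic p) = 0.
  by rewrite /padic_rem /digit res_pmul // -(res_mod z 0) modz1 mulr0 div0z.
have mulpI (a b : int) : p%:Z * a = p%:Z * b <-> a = b.
  by split=> [|->//]; apply: mulfI; rewrite -lt0n.
have congp k (x y : padic p) :
    padic_cong k.+1 (p%:R * x) (p%:R * y) <-> res x k = res y k.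
  by rewrite padic_congP // !res_pmul.
have hI k x y : res x k = res y k <-> res (h x) k = res (h y) k.
  (* Arguments and values both carry a factor [p], so suitability at level [k.+1] is the isometry
     property at level [k]. *)
  have := fs k.+1 _ _ (rc x) (rc y).
  rewrite !hE !rem0 !subr0 congp => <-.
  by rewrite -congp /padic_cong opprD addrACA subrr add0r.
have [w hw] := padic_isometry_surj h p0 hI 0.
exists (r%:R + p%:R * w); split; first by rewrite hE hw mulr0.
move=> _ [[v _ <-]]; rewrite hE => fv0; congr (_ + _ * _).
(* For composite [p] the ring is not a domain, so [p] is cancelled in the integer components: [h v]
   and [h w] agree at level [k] because [p * h v] and [p * h w] do at level [k.+1]. *)
apply: padicP => k; apply/hI/mulpI; rewrite -!res_pmul // fv0 hw.
by rewrite mulr0.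
Qed.
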